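(* Let $A\in\mathbb{R}^{m\times n}$, $C\in\mathbb{R}^{p\times n}$, $b\in\mathbb{R}^m$, and $G=A^{\mathsf T}A+C^{\mathsf T}C$. Let $x_2^\dagger=\bigl(\mathcal P_{\mathcal R(G)}-C_A^\dagger C\bigr)A^\dagger b$. Then $x_2^\dagger$ is the minimum 2-norm solution of $$\min_{x\in\mathcal N(C)}\|Ax-b\|_2 .$$
   Context: $\mathcal N(\cdot)$ and $\mathcal R(\cdot)$ denote null space and range; $\mathcal P_{\mathcal S}$ is the orthogonal projection (in the Euclidean inner product) onto a subspace $\mathcal S$; $M^\dagger$ is the Moore–Penrose pseudoinverse of a matrix $M$. The weighted pseudoinverse of $C$ with respect to $A$ is $C_A^\dagger:=\bigl(\mathrm I-(A\mathcal P_{\mathcal N(C)})^\dagger A\bigr)C^\dagger\in\mathbb{R}^{n\times p}$. The minimum 2-norm solution is the element of smallest Euclidean norm among all minimizers of $\|Ax-b\|_2$ over $x\in\mathcal N(C)$. *)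

(* Defs.v *)
From mathcomp Require Import all_boot all_order all_algebra.

Set Implicit Arguments.
Unset Strict Implicit.
Unset Printing Implicit Defensive.

Import Order.TTheory GRing.Theory Num.Theory.
Local Open Scope ring_scope.

(** The reals enter only as a real closed field, so every statement covers the
    field of real numbers. *)

Definition norm2 (R : rcfType) (n : nat) (x : 'cV[R]_n) : R :=
  Num.sqrt (\sum_i x i 0 ^+ 2).

Definition nullspace (R : rcfType) (m n : nat) (A : 'M[R]_(m, n)) :
    {vspace 'cV[R]_n} :=
  lker (linfun (mulmx A : 'cV[R]_n -> 'cV[R]_m)).

Definition range (R : rcfType) (m n : nat) (A : 'M[R]_(m, n)) :
    {vspace 'cV[R]_m} :=
  limg (linfun (mulmx A : 'cV[R]_n -> 'cV[R]_m)).

Lemma mem_nullspace (R : rcfType) m n (A : 'M[R]_(m, n)) (x : 'cV[R]_n) :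
  (x \in nullspace A) = (A *m x == 0).
Proof. by rewrite memv_ker lfunE. Qed.

Lemma mem_rangeP (R : rcfType) m n (A : 'M[R]_(m, n)) (y : 'cV[R]_m) :
  reflect (exists x : 'cV[R]_n, y = A *m x) (y \in range A).
Proof.
apply: (iffP memv_imgP) => [[x _ ->] | [x ->]]; exists x; rewrite ?lfunE //.
exact: memvf.
Qed.

(** The four Penrose equations. *)
Definition penrose (R : rcfType) (m n : nat)
    (A : 'M[R]_(m, n)) (X : 'M[R]_(n, m)) : bool :=
  [&& A *m X *m A == A, X *m A *m X == X,
      (A *m X)^T == A *m X & (X *m A)^T == X *m A].

Lemma row_sqr_eq0 (R : rcfType) n (v : 'rV[R]_n) : v *m v^T = 0 -> v = 0.
Proof.
move=> /matrixP/(_ 0 0); rewrite !mxE => /eqP.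
rewrite psumr_eq0 => [/allP v0 | i _]; last by rewrite mxE -expr2 sqr_ge0.
apply/rowP=> i; rewrite !mxE.
by have := v0 i (mem_index_enum i); rewrite mxE /= mulf_eq0 orbb => /eqP.
Qed.

Lemma gram_unitmx (R : rcfType) m n (F : 'M[R]_(m, n)) :
  row_free F -> F *m F^T \in unitmx.
Proof.
move=> freeF; rewrite -row_free_unit; apply: inj_row_free => v vFF.
apply: (row_free_inj freeF); rewrite mul0mx; apply: row_sqr_eq0.
by rewrite trmx_mul mulmxA -(mulmxA v) vFF mul0mx.
Qed.

Lemma penrose_exists (R : rcfType) m n (A : 'M[R]_(m, n)) :
  exists X, penrose A X.
Proof.
pose B := col_base A; pose F := row_base A.
have uF : F *m F^T \in unitmx by apply/gram_unitmx/row_base_free.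
have uB : B^T *m B \in unitmx.
  rewrite -{2}[B]trmxK; apply: gram_unitmx.
  by rewrite /row_free mxrank_tr; have := col_base_full A.
pose F' := F^T *m invmx (F *m F^T); pose B' := invmx (B^T *m B) *m B^T.
have FF' : F *m F' = 1%:M by rewrite mulmxA mulmxV.
have B'B : B' *m B = 1%:M by rewrite -mulmxA mulVmx.
have AX : A *m (F' *m B') = B *m B'.
  by rewrite -{1}(mulmx_base A) -/B -/F -mulmxA (mulmxA F) FF' mul1mx.
have XA : F' *m B' *m A = F' *m F.
  rewrite -[X in _ *m X = _](mulmx_base A) -/B -/F.
  by rewrite -mulmxA (mulmxA B') B'B mul1mx.
exists (F' *m B'); apply/and4P; split; apply/eqP.
- rewrite AX -[X in _ *m X = _](mulmx_base A) -/B -/F.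
  rewrite -mulmxA (mulmxA B') B'B mul1mx.
  exact: mulmx_base.
- by rewrite XA -mulmxA (mulmxA F) FF' mul1mx.
- rewrite AX [LHS]trmx_mul [B'^T]trmx_mul trmx_inv [(B^T *m B)^T]trmx_mul.
  by rewrite !trmxK -mulmxA.
- rewrite XA [LHS]trmx_mul [F'^T]trmx_mul trmx_inv [(F *m F^T)^T]trmx_mul.
  by rewrite !trmxK mulmxA.
Qed.

Definition mppinv (R : rcfType) (m n : nat) (A : 'M[R]_(m, n)) : 'M[R]_(n, m) :=
  xchoose (penrose_exists A).

Lemma mppinvP (R : rcfType) m n (A : 'M[R]_(m, n)) : penrose A (mppinv A).
Proof. exact: xchooseP. Qed.

Lemma penrose_uniq (R : rcfType) m n (A : 'M[R]_(m, n)) (X Y : 'M[R]_(n, m)) :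
  penrose A X -> penrose A Y -> X = Y.
Proof.
move=> /and4P[/eqP x1 /eqP x2 /eqP x3 /eqP x4].
move=> /and4P[/eqP y1 /eqP y2 /eqP y3 /eqP y4].
have AXY : A *m X = A *m Y.
  rewrite -x3 -[X in X *m _](y1) -(mulmxA _ A X) trmx_mul x3 y3.
  by rewrite mulmxA x1.
have XYA : X *m A = Y *m A.
  rewrite -x4 -[X in _ *m X](y1) -(mulmxA A Y A) mulmxA trmx_mul y4 x4.
  by rewrite -mulmxA (mulmxA A) x1.
by rewrite -x2 XYA -mulmxA AXY mulmxA y2.
Qed.

(** The rows of the matrix below are the transposed vectors of a basis of
    [S]. *)
Definition orthov (R : rcfType) (n : nat) (S : {vspace 'cV[R]_n}) :
    {vspace 'cV[R]_n} :=
  nullspace (\matrix_(i < \dim S, j < n) (vbasis S)`_i j 0).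

Lemma orthovP (R : rcfType) n (S : {vspace 'cV[R]_n}) (x : 'cV[R]_n) :
  reflect (forall u, u \in S -> u^T *m x = 0) (x \in orthov S).
Proof.
rewrite mem_nullspace; apply: (iffP eqP) => [Mx u /coord_vbasis -> | Sx].
  rewrite linear_sum /= mulmx_suml big1 // => i _.
  rewrite linearZ /= -scalemxAl; apply/matrixP => a b; rewrite !mxE.
  rewrite (_ : \sum_j _ = 0) ?mulr0 //.
  move/matrixP: Mx => /(_ i b); rewrite !mxE => Mxib; rewrite -[RHS]Mxib.
  by apply: eq_bigr => j _; rewrite !mxE (ord1 a).
apply/matrixP => i b; rewrite !mxE.
have Si : (vbasis S)`_i \in S by apply/vbasis_mem/mem_nth; rewrite size_tuple.
move/matrixP: (Sx _ Si) => /(_ 0 b); rewrite !mxE => Sxib; rewrite -[RHS]Sxib.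
by apply: eq_bigr => j _; rewrite !mxE.
Qed.

Lemma cap_orthov (R : rcfType) n (S : {vspace 'cV[R]_n}) :
  (S :&: orthov S = 0)%VS.
Proof.
apply/eqP; rewrite -subv0; apply/subvP => u /memv_capP[Su /orthovP/(_ u Su) uu].
rewrite memv0 -trmx_eq0; apply/eqP/row_sqr_eq0; by rewrite trmxK.
Qed.

Lemma add_orthov (R : rcfType) n (S : {vspace 'cV[R]_n}) :
  (S + orthov S = fullv)%VS.
Proof.
apply/eqP; rewrite eqEdim subvf dimv_disjoint_sum ?cap_orthov //=.
set f := linfun (mulmx (\matrix_(i < \dim S, j < n) (vbasis S)`_i j 0)
                  : 'cV[R]_n -> 'cV[R]_(\dim S)).
have := limg_ker_dim f fullv; rewrite capfv => <-.
rewrite addnC leq_add2r; apply: (leq_trans (dimvS (subvf _))).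
by rewrite dimvf /dim /= muln1.
Qed.

(** The matrix of the projection onto [S] along its orthogonal complement. *)
Definition orthproj (R : rcfType) (n : nat) (S : {vspace 'cV[R]_n}) : 'M[R]_n :=
  \matrix_(i, j) daddv_pi S (orthov S) (delta_mx j 0) i 0.

Lemma orthprojE (R : rcfType) n (S : {vspace 'cV[R]_n}) (x : 'cV[R]_n) :
  orthproj S *m x = daddv_pi S (orthov S) x.
Proof.
rewrite [in RHS](matrix_sum_delta x) linear_sum /=; apply/matrixP => i j.
rewrite !mxE summxE; apply: eq_bigr => k _.
by rewrite big_ord1 linearZ !mxE mulrC (ord1 j).
Qed.

Lemma orthproj_in (R : rcfType) n (S : {vspace 'cV[R]_n}) (x : 'cV[R]_n) :
  orthproj S *m x \in S.
Proof. by rewrite orthprojE memv_pi. Qed.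

Lemma orthproj_orth (R : rcfType) n (S : {vspace 'cV[R]_n}) (x : 'cV[R]_n) :
  x - orthproj S *m x \in orthov S.
Proof.
have xS : x \in (S + orthov S)%VS by rewrite add_orthov memvf.
rewrite orthprojE -{1}(daddv_pi_add (cap_orthov S) xS) addrC addKr.
exact: memv_pi.
Qed.

(** The weighted pseudoinverse of [C] with respect to [A]. *)
Definition wpinv (R : rcfType) (m n p : nat)
    (A : 'M[R]_(m, n)) (C : 'M[R]_(p, n)) : 'M[R]_(n, p) :=
  (1%:M - mppinv (A *m orthproj (nullspace C)) *m A) *m mppinv C.

Definition is_lsq_minimizer (R : rcfType) (m n : nat) (A : 'M[R]_(m, n))
    (b : 'cV[R]_m) (S : {vspace 'cV[R]_n}) (x : 'cV[R]_n) : Prop :=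
  x \in S /\
  forall y : 'cV[R]_n, y \in S -> norm2 (A *m x - b) <= norm2 (A *m y - b).

Definition is_min_norm_lsq (R : rcfType) (m n : nat) (A : 'M[R]_(m, n))
    (b : 'cV[R]_m) (S : {vspace 'cV[R]_n}) (x : 'cV[R]_n) : Prop :=
  is_lsq_minimizer A b S x /\
  forall y : 'cV[R]_n, is_lsq_minimizer A b S y -> norm2 x <= norm2 y.

(* Main.v *)
Require Import Defs.
From mathcomp Require Import all_boot all_order all_algebra.

Set Implicit Arguments.
Unset Strict Implicit.
Unset Printing Implicit Defensive.

Import Order.TTheory GRing.Theory Num.Theory.
Local Open Scope ring_scope.

(** With [P] the projection onto [N(C)] and [B = A P], every [y] in [N(C)] has
    [A y = B y], so two applications of Pythagoras show that [B^+ b] is the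
    unique minimum norm solution.  Since [R(A^T)] lies in [R(G)] and
    [P = I - C^+ C], the vector [x2] expands to
    [B^+ A A^+ b + (P - B^+ B) A^+ b].  The first term is [B^+ b] because [R(B)]
    lies in [R(A)]; the second vanishes because [P - B^+ B] projects onto
    [N(A)] intersected with [N(C)], which is orthogonal to [R(A^T)]. *)

Section Norm.
Context {R : rcfType}.
Implicit Types n : nat.

Lemma norm2_ge0 n (x : 'cV[R]_n) : 0 <= norm2 x.
Proof. exact: sqrtr_ge0. Qed.

Lemma norm2_sqr n (x : 'cV[R]_n) : norm2 x ^+ 2 = (x^T *m x) 0 0.
Proof.
rewrite sqr_sqrtr; last by apply: sumr_ge0 => i _; apply: sqr_ge0.
by rewrite mxE; apply: eq_bigr => i _; rewrite mxE expr2.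
Qed.

Lemma norm2_le n k (x : 'cV[R]_n) (y : 'cV[R]_k) :
  (norm2 x <= norm2 y) = (norm2 x ^+ 2 <= norm2 y ^+ 2).
Proof. by rewrite ler_sqr // nnegrE norm2_ge0. Qed.

Lemma gram_eq0 n (x : 'cV[R]_n) : x^T *m x = 0 -> x = 0.
Proof.
by rewrite -{2}[x]trmxK => /row_sqr_eq0 x0; rewrite -[x]trmxK x0 trmx0.
Qed.

Lemma norm2_sqr_le0 n (x : 'cV[R]_n) : norm2 x ^+ 2 <= 0 -> x = 0.
Proof.
move=> x0; have : norm2 x ^+ 2 == 0 by rewrite eq_le x0 sqr_ge0.
rewrite norm2_sqr => /eqP xx; apply: gram_eq0; apply/matrixP => i j.
by rewrite !ord1 xx mxE.
Qed.

Lemma norm2_pythagoras n (u v : 'cV[R]_n) :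
  u^T *m v = 0 -> norm2 (u + v) ^+ 2 = norm2 u ^+ 2 + norm2 v ^+ 2.
Proof.
move=> uv; have vu : v^T *m u = 0 by rewrite -[v^T *m u]trmxK trmx_mul trmxK uv trmx0.
by rewrite !norm2_sqr [(u + v)^T]linearD /= mulmxDl !mulmxDr uv vu addr0 add0r mxE.
Qed.

End Norm.

Section Pseudoinverse.
Context {R : rcfType} {m n : nat}.
Variable A : 'M[R]_(m, n).

Lemma mulmx_mppinvK : A *m mppinv A *m A = A.
Proof. by have /and4P[/eqP] := mppinvP A. Qed.

Lemma mppinv_mulmxK : mppinv A *m A *m mppinv A = mppinv A.
Proof. by have /and4P[_ /eqP] := mppinvP A. Qed.

Lemma tr_mulmx_mppinv : (A *m mppinv A)^T = A *m mppinv A.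
Proof. by have /and4P[_ _ /eqP] := mppinvP A. Qed.

Lemma tr_mppinv_mulmx : (mppinv A *m A)^T = mppinv A *m A.
Proof. by have /and4P[_ _ _ /eqP] := mppinvP A. Qed.

(** The columns of [mppinv A] thus lie in R(A^T), so a matrix that fixes or kills R(A^T) does the
    same to [mppinv A]. *)
Lemma mppinv_trl : mppinv A = A^T *m ((mppinv A)^T *m mppinv A).
Proof. by rewrite mulmxA -trmx_mul tr_mppinv_mulmx mppinv_mulmxK. Qed.

Lemma mppinv_trr : mppinv A = mppinv A *m (mppinv A)^T *m A^T.
Proof. by rewrite -mulmxA -trmx_mul tr_mulmx_mppinv mulmxA mppinv_mulmxK. Qed.

(** Normal equations: applied to b, this says that A^+ b solves A^T A x = A^T b. *)
Lemma trmx_mulmx_mppinv : A^T *m (A *m mppinv A) = A^T.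
Proof. by rewrite -tr_mulmx_mppinv -trmx_mul mulmx_mppinvK. Qed.

End Pseudoinverse.

Section Projection.
Context {R : rcfType}.

(** The difference of [y] and the projection lies both in [S] and in its orthogonal complement. *)
Lemma orthproj_eq n (S : {vspace 'cV[R]_n}) (x y : 'cV[R]_n) :
  y \in S -> x - y \in Defs.orthov S -> orthproj S *m x = y.
Proof.
move=> Sy Sxy; apply/eqP; rewrite -subr_eq0 -memv0 -(cap_orthov S) memv_cap.
rewrite rpredB ?orthproj_in //=.
have -> : orthproj S *m x - y = (x - y) - (x - orthproj S *m x).
  by rewrite opprB [RHS]addrC addrA subrK.
by rewrite rpredB ?orthproj_orth.
Qed.

Lemma orthproj_nullspace p n (C : 'M[R]_(p, n)) :
  orthproj (nullspace C) = 1%:M - mppinv C *m C.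
Proof.
suff PE (x : 'cV[R]_n) : orthproj (nullspace C) *m x = (1%:M - mppinv C *m C) *m x.
  by apply/trmx_inj/row_matrixP => i; rewrite -!tr_col !colE PE.
apply: orthproj_eq.
  by rewrite mem_nullspace mulmxA mulmxBr mulmx1 mulmxA mulmx_mppinvK subrr mul0mx.
apply/Defs.orthovP => u; rewrite mem_nullspace => /eqP Cu.
(* The removed part C^+ C x is orthogonal to [u] because C^+ C is symmetric and C u = 0. *)
rewrite mulmxBl mul1mx opprB addrC subrK mulmxA.
by rewrite -tr_mppinv_mulmx -trmx_mul -mulmxA Cu mulmx0 trmx0 mul0mx.
Qed.

(** The residual [w] of A^T y is orthogonal to R(G), so 0 = w^T G w = |A w|^2 + |C w|^2 and A w = 0.
    As [w] is also orthogonal to the projection, w^T w = (A^T y)^T w = y^T A w = 0. *)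
Lemma orthproj_range_gram m n p (A : 'M[R]_(m, n)) (C : 'M[R]_(p, n))
    (y : 'cV[R]_m) :
  orthproj (range (A^T *m A + C^T *m C)) *m (A^T *m y) = A^T *m y.
Proof.
set G := _ + _; set z := A^T *m y; set w := z - orthproj (range G) *m z.
have /Defs.orthovP Gw : w \in Defs.orthov (range G) by exact: orthproj_orth.
have trG : G^T = G by rewrite linearD /= !trmx_mul !trmxK.
have wGw : w^T *m (G *m w) = 0.
  by rewrite mulmxA -{1}trG -trmx_mul Gw //; apply/mem_rangeP; exists w.
have Aw : A *m w = 0.
  apply: norm2_sqr_le0; rewrite -(_ : (w^T *m (G *m w)) 0 0 = 0); last first.
    by rewrite wGw mxE.
  rewrite mulmxDl mulmxDr -!mulmxA !(mulmxA w^T) -!trmx_mul mxE -!norm2_sqr.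
  by rewrite lerDl sqr_ge0.
suff w0 : w = 0 by apply/esym/eqP; rewrite -subr_eq0 -/w w0.
apply: gram_eq0.
rewrite {1}/w [X in X *m _]linearB /= mulmxBl (Gw _ (orthproj_in _ _)) subr0.
by rewrite trmx_mul trmxK -mulmxA Aw mulmx0.
Qed.

End Projection.

Section ConstrainedLeastSquares.
Context {R : rcfType} {m n p : nat}.
Variables (A : 'M[R]_(m, n)) (C : 'M[R]_(p, n)).
Let P := orthproj (nullspace C).
Let B := A *m P.

Let mulCP : C *m P = 0.
Proof. by rewrite /P orthproj_nullspace mulmxBr mulmx1 mulmxA mulmx_mppinvK subrr. Qed.

Let trP : P^T = P.
Proof. by rewrite /P orthproj_nullspace linearB /= trmx1 tr_mppinv_mulmx. Qed.

Let mulPP : P *m P = P.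
Proof. by rewrite {1}/P orthproj_nullspace mulmxBl mul1mx -mulmxA mulCP mulmx0 subr0. Qed.

(** The columns of B^+ lie in R(B^T) = R(P A^T), hence in R(P). *)
Let mulPBinv : P *m mppinv B = mppinv B.
Proof. by rewrite mppinv_trl mulmxA [P *m B^T](_ : _ = B^T) // trmx_mul trP mulmxA mulPP. Qed.

Lemma min_norm_lsq_nullspace (b : 'cV[R]_m) :
  unique (is_min_norm_lsq A b (nullspace C)) (mppinv B *m b).
Proof.
set x := mppinv B *m b.
have AB : A *m x = B *m x by rewrite /x -{1}mulPBinv !mulmxA.
have NP y : y \in nullspace C -> A *m y = B *m y.
  rewrite mem_nullspace => /eqP Cy; rewrite -mulmxA /P orthproj_nullspace.
  by rewrite mulmxBl mul1mx -mulmxA Cy mulmx0 subr0.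
have Nx : x \in nullspace C.
  by rewrite mem_nullspace /x -mulPBinv !mulmxA mulCP !mul0mx.
have normal_eq : B^T *m (A *m x - b) = 0.
  by rewrite AB /x [B *m _]mulmxA mulmxBr mulmxA trmx_mulmx_mppinv subrr.
have residual y : y \in nullspace C -> norm2 (A *m y - b) ^+ 2 =
    norm2 (B *m (y - x)) ^+ 2 + norm2 (A *m x - b) ^+ 2.
  move=> Ny; rewrite -norm2_pythagoras.
    by rewrite (NP y) // AB mulmxBr addrA subrK.
  by rewrite trmx_mul -mulmxA normal_eq mulmx0.
have minx : is_lsq_minimizer A b (nullspace C) x.
  by split=> // y Ny; rewrite norm2_le (residual y) // lerDr sqr_ge0.
have normy y : is_lsq_minimizer A b (nullspace C) y ->
    norm2 y ^+ 2 = norm2 x ^+ 2 + norm2 (y - x) ^+ 2.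
  (* Comparing [y] with [x] in [residual] forces B (y - x) = 0. *)
  move=> [Ny /(_ x Nx)]; rewrite norm2_le residual // gerDr => /norm2_sqr_le0 Byx.
  rewrite -norm2_pythagoras ?(addrC x) ?subrK //.
  (* Since x = B^+ B x with B^+ B symmetric, [x] is orthogonal to N(B), which contains y - x. *)
  have {1}-> : x = mppinv B *m B *m x by rewrite /x mulmxA mppinv_mulmxK.
  by rewrite trmx_mul tr_mppinv_mulmx -2!mulmxA Byx !mulmx0.
split; first by split=> // y /normy ny; rewrite norm2_le ny lerDl sqr_ge0.
move=> y [miny /(_ x minx)]; rewrite norm2_le (normy y miny) gerDl.
by move=> /norm2_sqr_le0/eqP; rewrite subr_eq0 => /eqP.
Qed.

Lemma mppinv_mul_orthproj :
  (orthproj (range (A^T *m A + C^T *m C)) - wpinv A C *m C) *m mppinv A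
    = mppinv B.
Proof.
have PGA : orthproj (range (A^T *m A + C^T *m C)) *m mppinv A = mppinv A.
  apply/trmx_inj/row_matrixP => i; rewrite -!tr_col !colE.
  by rewrite mppinv_trl -!mulmxA orthproj_range_gram.
(* B^+ ends in the factor B^T = P A^T, and A^T absorbs A A^+. *)
have BAA : mppinv B *m (A *m mppinv A) = mppinv B.
  rewrite mppinv_trr -mulmxA [B^T]trmx_mul.
  by rewrite -(mulmxA P^T) trmx_mulmx_mppinv.
(* Since B^+ = P B^+, the product A B^+ B equals B B^+ B = B. *)
have AQ : A *m (P - mppinv B *m B) = 0.
  rewrite mulmxBr -/B [A *m _]mulmxA -mulPBinv [A *m (P *m _)]mulmxA.
  by rewrite mulmx_mppinvK subrr.
(* P - B^+ B is symmetric, so transposing [AQ] shows that it kills R(A^T). *)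
have QA : (P - mppinv B *m B) *m mppinv A = 0.
  rewrite [mppinv A]mppinv_trl mulmxA -[X in X *m A^T]trmxK -trmx_mul.
  by rewrite [(P - _)^T]linearB /= trP tr_mppinv_mulmx AQ trmx0 mul0mx.
have CC : mppinv C *m C = 1%:M - P.
  by rewrite /P orthproj_nullspace opprB addrC subrK.
have wpinvC : wpinv A C *m C = 1%:M - (P - mppinv B *m B) - mppinv B *m A.
  rewrite /wpinv -/P -/B -(mulmxA _ (mppinv C)) CC mulmxBr mulmx1.
  by rewrite mulmxBl mul1mx -(mulmxA _ A P) -/B addrAC.
rewrite mulmxBl PGA wpinvC 2!mulmxBl mul1mx QA subr0 -mulmxA BAA.
by rewrite opprB addrC subrK.
Qed.

End ConstrainedLeastSquares.

Theorem theorem3p3 (R : rcfType) (m n p : nat)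
    (A : 'M[R]_(m, n)) (C : 'M[R]_(p, n)) (b : 'cV[R]_m) :
  let G := A^T *m A + C^T *m C in
  let x2 := (orthproj (range G) - wpinv A C *m C) *m mppinv A *m b in
  unique (is_min_norm_lsq A b (nullspace C)) x2.
Proof.
by move=> G x2; rewrite /x2 mppinv_mul_orthproj; apply: min_norm_lsq_nullspace.
Qed.
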